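(* Let $X$ be a countable set with at least two elements, let $\mathcal{B}=(\underline{B},E)$ be a condition set for $X^\omega$ with $\underline{B}$ countable, let $\lambda$ be an infinite ordinal, and let $A\subset X^\omega$ with $A=\mathrm{p}(C)$ for a set $C\subset X^\omega\times\lambda^\omega$. Then: (i) If Player I has a winning strategy in the game $G^{\mathcal{B}}_p(C)$, then $A$ contains a nonempty $\mathcal{B}$-perfect subset. (ii) If Player II has a winning strategy in the game $G^{\mathcal{B}}_p(C)$, then $A$ is $\mathcal{B}^\lambda$-meager.
   Context: $\mathrm{p}(C)=\{f\in X^\omega:\exists\xi\in\lambda^\omega\ (f,\xi)\in C\}$. $X^{<\omega}$ is the set of finite sequences in $X$, $X^{<\omega}_*$ the set of nonempty ones; $u\prec v$ means $u$ is an initial segment of $v$ (possibly equal; $v$ may be infinite); the dot in $u\cdot v$ denotes concatenation of sequences. $X^\omega$ carries the topology with basic open sets $O_u=\{f\in X^\omega: u\prec f\}$. For $D\subset X^\omega$, $T_D$ is the set of finite initial segments of elements of $D$. Condition set: Let $\underline{B}$ be a nonempty set (of ''conditions'') and $E$ a function assigning to each $b\in\underline{B}$ a nonempty set $E(b)\subset X^{<\omega}_*$; write $u\Vdash b$ for $u\in E(b)$. $\mathcal{B}=(\underline{B},E)$ is a condition set for $X^\omega$ if: (1) for all $u,v\in X^{<\omega}_*$, $b\in\underline{B}$: $u\prec v$ and $u\Vdash b$ imply $v\Vdash b$; (2) for every $x\in X$ there is $b\in\underline{B}$ such that for all $u\in X^{<\omega}_*$: $u\Vdash b$ implies $u(0)\neq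 x$; (3) there is a map $l:\underline{B}\to\omega$ such that for all $b\in\underline{B}$ and $u,v\in X^{<\omega}_*$ with $u\prec v$, $u\not\Vdash b$, $v\Vdash b$, there is $b'\in\underline{B}$ with $l(b')<l(b)$ and, for all $w\in X^{<\omega}_*$, $w\Vdash b'\Leftrightarrow u\cdot w\Vdash b$. $\mathcal{B}^\lambda$-meager: A closed set $D\subset X^\omega$ is $\mathcal{B}$-nowhere dense if for every $u\in T_D$ there is $b\in\underline{B}$ such that for all $v\in X^{<\omega}_*$: $u\cdot v\in T_D$ implies $v\not\Vdash b$. A set $A\subset X^\omega$ is $\mathcal{B}^\lambda$-meager if $A\subset\bigcup_{i<\lambda}A_i$ for some (closed) $\mathcal{B}$-nowhere dense sets $A_i\subset X^\omega$ ($i<\lambda$). $\mathcal{B}$-perfect: A tree $J$ on $X^{<\omega}$ is a subset of $(X^{<\omega})^{<\omega}$ closed under initial segments; $J_*$ is $J$ without the empty sequence. $J$ is $\mathcal{B}$-perfect if (1) for all $p\in J_*$ and $b\in\underline{B}$ there are $u\in X^{<\omega}_*$ and $u'\succ u$ with $p\cdot(u)\in J$ and $u'\Vdash b$; and (2) for all $p\in J$, if $p\cdot(u),p\cdot(v)\in J$ and $u\ne v$, then $u,v$ are incompatible (neither is an initial segment of the other). For such $J$, $[J]=\{f\in X^\omega:\forall n<\omega\ \exists(s_0,\ldots,s_n)\in J\ (s_0\cdots s_n\prec f)\}$, where $s_0\cdots s_n$ is the concatenation of $s_0,\ldots,s_n$. A set is $\mathcal{B}$-perfect if it equals $[J]$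 for some $\mathcal{B}$-perfect tree $J$ on $X^{<\omega}$. The game $G^{\mathcal{B}}_p(C)$: with perfect information, I plays $(\xi_0,u_0)$, II plays $b_1$, I plays $(\xi_1,u_1)$, II plays $b_2$, I plays $(\xi_2,u_2)$, and so on, with $\xi_i\in\lambda$, $u_i\in X^{<\omega}_*$, $b_i\in\underline{B}$. Let $\xi=(\xi_0,\xi_1,\ldots)$ and $f=u_0\cdot u_1\cdot u_2\cdots$. I wins if $(f,\xi)\in C$ and $u_i\Vdash b_i$ for all $i\geq1$; otherwise II wins. *)

(* Defs.v *)
From HB Require Import structures.
From mathcomp Require Import all_boot all_order.
From mathcomp Require Import boolp classical_sets functions cardinality wochoice.
From mathcomp Require Import topology.

Set Implicit Arguments.
Unset Strict Implicit.
Unset Printing Implicit Defensive.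

Local Open Scope classical_set_scope.

(* An alias of [nat -> X], so that the topology below does not interfere with
   the product topology on function types. *)
Definition infseq (X : eqType) : Type := nat -> X.

Definition prefix_inf (X : eqType) (u : seq X) (f : infseq X) : Prop :=
  mkseq f (size u) = u.

Definition cylinder (X : eqType) (u : seq X) : set (infseq X) :=
  [set f | prefix_inf u f].

(* The base of the topology must be indexed by a pointed type. *)
Definition cylinder_index (X : eqType) : Type := seq X.

Section Topology.
Variable X : eqType.

HB.instance Definition _ := gen_eqMixin (infseq X).
HB.instance Definition _ := gen_choiceMixin (infseq X).

HB.instance Definition _ := gen_eqMixin (cylinder_index X).
HB.instance Definition _ := gen_choiceMixin (cylinder_index X).
HB.instance Definition _ := isPointed.Build (cylinder_index X) [::].

Let cylinder_cover :
  \bigcup_(u in [set: cylinder_index X]) cylinder u = [set: infseq X].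
Proof. by rewrite -subTset => f _; exists [::]. Qed.

Let cylinder_join (u v : cylinder_index X) (f : infseq X) :
  [set: cylinder_index X] u -> [set: cylinder_index X] v ->
  cylinder u f -> cylinder v f ->
  exists w : cylinder_index X,
    [/\ [set: cylinder_index X] w, cylinder w f &
        cylinder w `<=` cylinder u `&` cylinder v].
Proof.
move=> _ _ uf vf; exists (mkseq f (maxn (size u) (size v))); split=> //.
  by rewrite /cylinder /= /prefix_inf size_mkseq.
move=> g; rewrite /cylinder /= /prefix_inf size_mkseq => fg.
have E n : n <= maxn (size u) (size v) -> mkseq g n = mkseq f n.
  move=> le_n; apply/eq_in_map => i; rewrite mem_iota add0n => /= lt_in.
  have lt_im := leq_trans lt_in le_n.
  by have /(congr1 (fun s => nth (f 0) s i)) := fg; rewrite !nth_mkseq.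
by split; rewrite E ?leq_maxl ?leq_maxr.
Qed.

HB.instance Definition _ :=
  isBaseTopological.Build (infseq X) cylinder_cover cylinder_join.

End Topology.

(* [E b u] reads "u forces b". *)
Definition condition_set (X : eqType) (B : Type) (E : B -> set (seq X)) : Prop :=
  [/\ [set: B] !=set0 /\
        (forall b, E b !=set0 /\ E b `<=` [set u | u != [::]]),
      forall (u v : seq X) b, u != [::] -> v != [::] ->
        prefix u v -> E b u -> E b v,
      forall x : X, exists b, forall u : seq X, u != [::] -> E b u ->
        nth x u 0 <> x
    & exists l : B -> nat, forall b (u v : seq X), u != [::] -> v != [::] ->
        prefix u v -> ~ E b u -> E b v ->
        exists2 b', l b' < l b &
          forall w : seq X, w != [::] -> (E b' w <-> E b (u ++ w))].

Definition segments (X : eqType) (D : set (infseq X)) : set (seq X) :=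
  [set u | exists2 f, D f & prefix_inf u f].

Definition nowhere_dense_for (X : eqType) (B : Type) (E : B -> set (seq X))
    (D : set (infseq X)) : Prop :=
  closed D /\
  forall u, segments D u -> exists b, forall v : seq X, v != [::] ->
    segments D (u ++ v) -> ~ E b v.

Definition meager_for (X : eqType) (B : Type) (E : B -> set (seq X))
    (L : Type) (A : set (infseq X)) : Prop :=
  exists F : L -> set (infseq X),
    (forall i, nowhere_dense_for E (F i)) /\ A `<=` \bigcup_(i in [set: L]) F i.

Definition is_tree (X : eqType) (J : set (seq (seq X))) : Prop :=
  forall p q, prefix p q -> J q -> J p.

Definition perfect_tree (X : eqType) (B : Type) (E : B -> set (seq X))
    (J : set (seq (seq X))) : Prop :=
  [/\ is_tree J,
      forall p b, J p -> p != [::] ->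
        exists u u' : seq X,
          [/\ u != [::], prefix u u', J (rcons p u) & E b u']
    & forall p (u v : seq X), J p -> J (rcons p u) -> J (rcons p v) -> u <> v ->
        ~~ prefix u v /\ ~~ prefix v u].

Definition body (X : eqType) (J : set (seq (seq X))) : set (infseq X) :=
  [set f | forall n, exists s : seq (seq X),
             [/\ size s = n.+1, J s & prefix_inf (flatten s) f]].

Definition perfect_for (X : eqType) (B : Type) (E : B -> set (seq X))
    (P : set (infseq X)) : Prop :=
  exists2 J, perfect_tree E J & P = body J.

Definition p_proj (X : eqType) (L : Type) (C : set (infseq X * (nat -> L))) :
    set (infseq X) :=
  [set f | exists xi, C (f, xi)].

Definition infcat (X : eqType) (u : nat -> seq X) (f : infseq X) : Prop :=
  forall n, prefix_inf (flatten (mkseq u n)) f.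

Lemma infcat_exists_unique (X : eqType) (u : nat -> seq X) :
  (forall n, u n != [::]) -> exists! f, infcat u f.
Proof.
move=> u0.
have flS n : flatten (mkseq u n.+1) = flatten (mkseq u n) ++ u n.
  by rewrite mkseqS -cats1 flatten_cat /= cats0.
have sz n : n <= size (flatten (mkseq u n)).
  elim: n => // n IHn; rewrite flS size_cat -addn1 leq_add //.
  by rewrite lt0n size_eq0.
have x0 : X by case: (u 0) (u0 0).
have nthE n m i : n <= m -> i < size (flatten (mkseq u n)) ->
    nth x0 (flatten (mkseq u m)) i = nth x0 (flatten (mkseq u n)) i.
  move=> le_nm lt_i; have [k ->] : exists k, m = n + k.
    by exists (m - n); rewrite subnKC.
  elim: k => [|k IHk]; first by rewrite addn0.
  rewrite addnS flS nth_cat IHk; case: ifP => // /negbT.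
  rewrite -leqNgt => le_i; suff : i < i by rewrite ltnn.
  apply: (leq_trans lt_i); apply: leq_trans le_i.
  elim: k {IHk} => [|k IHk]; first by rewrite addn0.
  by rewrite addnS flS size_cat (leq_trans IHk) ?leq_addr.
exists (fun i => nth x0 (flatten (mkseq u i.+1)) i); split.
  move=> n; apply: (@eq_from_nth _ x0); rewrite size_mkseq // => i lt_i.
  rewrite nth_mkseq //; case: (leqP n i.+1) => le_n; first exact: nthE.
  by apply/esym/nthE; [apply: ltnW | apply: sz].
move=> f fP; apply: funext => i; have lt_i := sz i.+1.
by rewrite -(fP i.+1) nth_mkseq.
Qed.

Section Game.
Variables (X : eqType) (B : Type) (E : B -> set (seq X)) (L : Type).
Variable C : set (infseq X * (nat -> L)).

Definition moveI : Type := (L * {u : seq X | u != [::]})%type.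

(* The infinite concatenation [f] of nonempty words exists and is unique
   ([infcat_exists_unique]), so the [exists2] below merely names it.
   In a run [(a, b)], [a i] is the move (xi_i, u_i) of I, and [b i] is the
   move b_(i+1) of II, which answers [a i]. *)
Definition wins_I (a : nat -> moveI) (b : nat -> B) : Prop :=
  (exists2 f, infcat (fun i => sval (a i).2) f & C (f, fun i => (a i).1)) /\
  forall i, E (b i) (sval (a i.+1).2).

(* A strategy takes the moves of I and the moves of II made so far; the player
   using it wins every run in which all of that player's moves follow it. *)
Definition I_has_winning_strategy : Prop :=
  exists sigma : seq moveI -> seq B -> moveI,
    forall a b, (forall n, a n = sigma (mkseq a n) (mkseq b n)) -> wins_I a b.

Definition II_has_winning_strategy : Prop :=
  exists tau : seq moveI -> seq B -> B,
    forall a b, (forall n, b n = tau (mkseq a n.+1) (mkseq b n)) ->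
      ~ wins_I a b.

End Game.

(* Main.v *)
Require Import Defs.
From mathcomp Require Import all_boot all_order.
From mathcomp Require Import boolp classical_sets functions cardinality wochoice.
From mathcomp Require Import topology.

(** Part (i). Fix a winning strategy of I. At each position, the answers of I
   to the various conditions are words that may well be comparable; the tree
   [J] keeps only the answers with no proper initial segment among the answers
   at that position. Siblings are then incompatible, and each condition [b] is
   still forced by an extension of a sibling, namely by the answer to [b]. By
   incompatibility a point of the body of [J] determines a branch of [J], hence
   a play against the strategy that produces this point; I wins it, so the
   point lies in the projection of [C] ([winning_I_perfect]).

   Part (ii). Fix a winning strategy of II and a point [f] of the projection,
   witnessed by [xi]. If at each position along [(f, xi)] player I could
   lengthen the last word along [f] so that some further word along [f] forces
   the reply of II, then I could win. So [f] lies in one of the sets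
   [stuck q m], consisting of the points that extend the position [rcons q m]
   and along which every lengthening of the last word meets a reply that no
   further word along the point forces ([winning_II_stuck]). These sets are closed and nowhere
   dense: at a segment [u] beyond the position, the reply to the position
   lengthened to [u] is the required condition ([stuck_nowhere_dense]).

   There are as many positions as finite sequences of labels, because [X] is
   countable and the set [L] of labels is infinite. Part (ii) therefore also
   needs an injection of [seq L] into [L], which rests on the equality of an
   infinite cardinal with its square ([infinite_pairing]). *)

Set Implicit Arguments.
Unset Strict Implicit.
Unset Printing Implicit Defensive.

Local Open Scope classical_set_scope.

(** * Cardinal arithmetic *)

Lemma chain_common (T : Type) (F : set (set T)) (G H : set T) (t t' : T) :
  total_on F subset -> F G -> F H -> G t -> H t' ->
  exists2 K, F K & K t /\ K t'.
Proof.
move=> tot FG FH Gt Ht'; have [GH|HG] := tot _ _ FG FH.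
  by exists H => //; split=> //; apply: GH.
by exists G => //; split=> //; apply: HG.
Qed.

Lemma infinite_nat_injection (T : Type) : infinite_set [set: T] ->
  exists i : nat -> T, injective i.
Proof.
move=> /infiniteP/card_leP[f].
exists (fun n => set_val (f (SigSub (mem_set (I : [set: nat] n))))).
by move=> m n /val_inj /(inj (in_setT _) (in_setT _)) [].
Qed.

(** Reading the underlying set off the diagonal lets Zorn's lemma run on the
   relations alone. *)
Definition pairing_field (T : Type) (G : set (T * T * T)) : set T :=
  [set x | exists z, G (x, x, z)].

(** An injection of the square of a set into that set, encoded as the set of
   triples [(x, y, z)] where [z] codes [(x, y)]; a pair may have several
   codes. *)
Definition partial_pairing (T : Type) (G : set (T * T * T)) : Prop :=
  [/\ forall x y z, G (x, y, z) ->
        [/\ pairing_field G x, pairing_field G y & pairing_field G z],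
      forall x y, pairing_field G x -> pairing_field G y -> exists z, G (x, y, z)
    & forall x y x' y' z, G (x, y, z) -> G (x', y', z) -> x = x' /\ y = y'].

(** Each clause involves at most two triples, and these lie in a common member
   of the chain. *)
Lemma partial_pairing_bigcup (T : Type) (F : set (set (T * T * T))) :
  F `<=` @partial_pairing T -> total_on F subset ->
  partial_pairing (\bigcup_(G in F) G).
Proof.
move=> Fp tot.
split.
- move=> x y z [G FG Gxyz]; have [fG _ _] := Fp _ FG.
  have [[x' Gx] [y' Gy] [z' Gz]] := fG _ _ _ Gxyz.
  by split; [exists x'|exists y'|exists z']; exists G.
- move=> x y [x' [G FG Gx]] [y' [H FH Hy]].
  have [K FK [Kx Ky]] := chain_common tot FG FH Gx Hy.
  have [_ tK _] := Fp _ FK.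
  by have [|| z Kz] := tK x y; [by exists x'|by exists y'|exists z; exists K].
- move=> x y x' y' z [G FG Gt] [H FH Ht].
  have [K FK [K1 K2]] := chain_common tot FG FH Gt Ht.
  by have [_ _ iK] := Fp _ FK; apply: iK K1 K2.
Qed.

(** A maximal partial injection of [A] into [B] exhausts [A] or [B], and in the
   second case its converse is an injection of [B] into [A]. *)
Lemma set_injections_total (T : Type) (A B : set T) :
  (exists2 j : T -> T, forall x, A x -> B (j x) &
     forall x y, A x -> A y -> j x = j y -> x = y) \/
  (exists2 j : T -> T, forall x, B x -> A (j x) &
     forall x y, B x -> B y -> j x = j y -> x = y).
Proof.
pose P (G : set (T * T)) :=
  [/\ forall x y, G (x, y) -> A x /\ B y,
      forall x y y', G (x, y) -> G (x, y') -> y = y'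
    & forall x x' y, G (x, y) -> G (x', y) -> x = x'].
have [F FP tot|G [[GAB Gfun Ginj] Gmax]] := @Zorn_bigcup _ P.
  split.
  - by move=> x y [G FG Gxy]; have [+ _ _] := FP _ FG; apply.
  - move=> x y y' [G FG Gt] [H FH Ht].
    have [K FK [K1 K2]] := chain_common tot FG FH Gt Ht.
    by have [_ + _] := FP _ FK; apply; [apply: K1|].
  - move=> x x' y [G FG Gt] [H FH Ht].
    have [K FK [K1 K2]] := chain_common tot FG FH Gt Ht.
    by have [_ _ +] := FP _ FK; apply; [apply: K1|].
have [Adom|Adom] := EM (forall x, A x -> exists y, G (x, y)).
  left; have /choice[j jP] : forall x, exists y, A x -> G (x, y).
    by move=> x; have [/Adom[y Gxy]|nAx] := EM (A x); [exists y|exists x].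
  exists j => [x /jP/GAB[]//|x y /jP Gx /jP Gy e].
  by apply: Ginj Gx _; rewrite e.
have [Bran|Bran] := EM (forall y, B y -> exists x, G (x, y)).
  right; have /choice[j jP] : forall y, exists x, B y -> G (x, y).
    by move=> y; have [/Bran[x Gxy]|nBy] := EM (B y); [exists x|exists y].
  exists j => [y /jP/GAB[]//|x y /jP Gx /jP Gy e].
  by apply: Gfun Gx _; rewrite e.
exfalso.
have [a /not_implyP[Aa Ga]] : exists a, ~ (A a -> exists y, G (a, y)).
  exact/existsNP.
have [b /not_implyP[Bb Gb]] : exists b, ~ (B b -> exists x, G (x, b)).
  exact/existsNP.
have {}Ga y : ~ G (a, y) by move=> ?; apply: Ga; exists y.
have {}Gb x : ~ G (x, b) by move=> ?; apply: Gb; exists x.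
apply: (Gmax (G `|` [set (a, b)])).
  split; first by move=> t; left.
  by move=> /(_ (a, b) (or_intror erefl)) /Ga.
split.
- by move=> x y [/GAB//|[-> ->]].
- move=> x y y' [Gy|[ex ey]] [Gy'|[ex' ey']]; subst => //.
  + exact: Gfun Gy Gy'.
  + by have := Ga _ Gy.
  + by have := Ga _ Gy'.
- move=> x x' y [Gy|[ex ey]] [Gy'|[ex' ey']]; subst => //.
  + exact: Ginj Gy Gy'.
  + by have := Gb _ Gy.
  + by have := Gb _ Gy'.
Qed.

Lemma partial_pairing_fun (T : Type) (G : set (T * T * T)) :
  partial_pairing G ->
  exists g : T * T -> T,
    (forall x y, pairing_field G x -> pairing_field G y ->
       pairing_field G (g (x, y))) /\
    (forall x y x' y', pairing_field G x -> pairing_field G y ->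
       pairing_field G x' -> pairing_field G y' ->
       g (x, y) = g (x', y') -> x = x' /\ y = y').
Proof.
move=> [Gfld Gtot Ginj]; set S := pairing_field G in Gfld Gtot *.
have /choice[g gP] : forall p : T * T, exists z, S p.1 -> S p.2 -> G (p, z).
  move=> [x y]; have [[Sx Sy]|nS] := EM (S x /\ S y).
    by have [z Gz] := Gtot _ _ Sx Sy; exists z.
  by exists x => Sx Sy; case: nS.
exists g; split=> [x y Sx Sy|x y x' y' Sx Sy Sx' Sy' e].
  by have [] := Gfld _ _ _ (gP (x, y) Sx Sy).
by apply: Ginj (gP (x, y) Sx Sy) _; rewrite e; apply: (gP (x', y')).
Qed.

(** If the field [S] of a pairing has two points and injects into its
   complement by [j], the pairing extends to [S] together with the image of
   [j]: a pair of points that are not both in [S] is coded by the image under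
   [j] of the code of the two points of [S] they come from and of the two
   sides they lie on, which the points [c b] stand for. *)
Lemma partial_pairing_extend (T : Type) (G : set (T * T * T)) (c : bool -> T)
    (j : T -> T) :
  partial_pairing G -> (forall b, pairing_field G (c b)) -> injective c ->
  (forall x, pairing_field G x -> ~ pairing_field G (j x)) ->
  (forall x y, pairing_field G x -> pairing_field G y -> j x = j y -> x = y) ->
  exists2 G', G `<` G' & partial_pairing G'.
Proof.
move=> Gp Sc c_inj jS j_inj; have [Gfld Gtot Ginj] := Gp.
have [g [gS g_inj]] := partial_pairing_fun Gp.
set S := pairing_field G in Gfld Gtot Sc jS j_inj gS g_inj.
pose dec (b : bool) x := if b then j x else x.
pose code b x b' y := j (g (g (x, y), g (c b, c b'))).
have pS b x b' y : S x -> S y -> S (g (g (x, y), g (c b, c b'))).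
  by move=> Sx Sy; apply: (gS _ _ (gS _ _ Sx Sy) (gS _ _ (Sc b) (Sc b'))).
have dec_inj b x b' x' : S x -> S x' -> dec b x = dec b' x' -> b = b' /\ x = x'.
  case: b b' => [] [] Sx Sx' /= e.
  - by split=> //; apply: j_inj.
  - by case: (jS x Sx); rewrite e.
  - by case: (jS x' Sx'); rewrite -e.
  - by [].
have code_inj b x b' y d x' d' y' : S x -> S y -> S x' -> S y' ->
    code b x b' y = code d x' d' y' -> [/\ b = d, x = x', b' = d' & y = y'].
  move=> Sx Sy Sx' Sy' e.
  have {}e := j_inj _ _ (pS b _ b' _ Sx Sy) (pS d _ d' _ Sx' Sy') e.
  have [] := g_inj _ _ _ _ (gS _ _ Sx Sy) (gS _ _ (Sc b) (Sc b'))
                   (gS _ _ Sx' Sy') (gS _ _ (Sc d) (Sc d')) e.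
  by move=> /g_inj[] // -> -> /g_inj[] // /c_inj -> /c_inj ->.
pose G' := G `|` [set t | exists b x b' y, [/\ S x, S y, b || b' &
                     t = (dec b x, dec b' y, code b x b' y)]].
have fldE b x : S x -> pairing_field G' (dec b x).
  case: b => Sx /=; last by have [z Gz] := Sx; exists z; left.
  by exists (code true x true x); right; exists true, x, true, x.
exists G'.
  split; first by move=> t; left.
  pose x := c true => sub; apply: (jS x (Sc true)).
  have [] // := Gfld (j x) (j x) (code true x true x).
  by apply: sub; right; exists true, x, true, x; split=> //; apply: Sc.
split.
- move=> x y z [/Gfld[Sx Sy Sz]|[b [x0 [b' [y0 [Sx Sy _ [-> -> ->]]]]]]].
    by split; [apply: (fldE false)..].
  split; [exact: fldE..|]; apply: (fldE true).
  exact: pS.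
- have fldP x : pairing_field G' x -> exists b x0, S x0 /\ x = dec b x0.
    move=> [z [/Gfld[Sx _ _]|[b [x0 [b' [y0 [Sx Sy _ [-> _ _]]]]]]]].
      by exists false, x.
    by exists b, x0.
  move=> _ _ /fldP[b [x [Sx ->]]] /fldP[b' [y [Sy ->]]].
  have [bb'|] := boolP (b || b').
    by exists (code b x b' y); right; exists b, x, b', y.
  case: b b' => [] [] // _; have [z Gz] := Gtot _ _ Sx Sy.
  by exists z; left.
- have clash x y b x0 b' y0 : S x0 -> S y0 ->
      G (x, y, code b x0 b' y0) -> False.
    move=> Sx0 Sy0 /Gfld[_ _]; apply: jS.
    exact: pS.
  move=> x y x' y' z [Gz|[b [x0 [b' [y0 [Sx Sy _ [-> -> ->]]]]]]].
    move=> [Gz'|[b [x0 [b' [y0 [Sx Sy _ [_ _ ez]]]]]]]; first exact: Ginj Gz Gz'.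
    by rewrite ez in Gz; case: (clash _ _ _ _ _ _ Sx Sy Gz).
  move=> [/clash[]//|[d [x1 [d' [y1 [Sx1 Sy1 _ [-> -> e]]]]]]].
  by have [-> -> -> ->] := code_inj _ _ _ _ _ _ _ _ Sx Sy Sx1 Sy1 e.
Qed.

(** Hessenberg's theorem, by Zorn's lemma: a maximal pairing containing one on
   a countably infinite set has a field whose complement injects into the
   field, by [partial_pairing_extend] and comparability, and then so does the
   whole type. *)
Lemma infinite_pairing (T : Type) : infinite_set [set: T] ->
  exists h : T * T -> T, injective h.
Proof.
move=> /infinite_nat_injection[i i_inj].
pose G0 := [set t | exists m n : nat, t = (i m, i n, i (pickle (m, n)))].
have G0p : partial_pairing G0.
  have fld n : pairing_field G0 (i n) by exists (i (pickle (n, n))), n, n.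
  have fldP x : pairing_field G0 x -> exists n, x = i n.
    by move=> [z [m [n [-> _ _]]]]; exists m.
  split.
  - by move=> x y z [m [n [-> -> ->]]].
  - by move=> _ _ /fldP[m ->] /fldP[n ->]; exists (i (pickle (m, n))), m, n.
  - move=> x y x' y' z [m [n [-> -> ->]]] [m' [n' [-> -> /i_inj]]].
    by move=> /(pcan_inj (@pickleK _)) [-> ->].
(* The empty relation is the union of the empty chain. *)
pose P G := G = set0 \/ G0 `<=` G /\ @partial_pairing T G.
have [F FP tot|G [PG Gmax]] := @Zorn_bigcup _ P.
  have [[G1 [FG1 G1n0]]|F0] := EM (exists G, F G /\ G <> set0).
    right; split.
      move=> t G0t; exists G1 => //.
      by have [//|[sub _]] := FP _ FG1; apply: sub.
    have -> : \bigcup_(G in F) G = \bigcup_(G in [set G | F G /\ G <> set0]) G.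
      apply/seteqP; split=> t [G FG Gt]; exists G => //; last by case: FG.
      by split=> // G0'; rewrite G0' in Gt.
    apply: partial_pairing_bigcup.
      by move=> G [FG Gn0]; have [|[]] := FP _ FG.
    by move=> G H [FG _] [FH _]; apply: tot.
  left; rewrite -subset0 => t [G FG Gt].
  by apply: F0; exists G; split=> // G0'; rewrite G0' in Gt.
have [sub Gp] : G0 `<=` G /\ partial_pairing G.
  case: PG => // G0'; exfalso; apply: (Gmax G0); last by right; split.
  rewrite G0'; split=> // sub.
  by apply: (sub (i 0, i 0, i (pickle (0, 0)))); exists 0, 0.
pose c (b : bool) := i b.
have c_inj : injective c by move=> [] [] /i_inj.
have Sc b : pairing_field G (c b).
  by exists (i (pickle (b : nat, b : nat))); apply: sub; exists b, b.
have [[j jS j_inj]|[j jS j_inj]] :=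
  set_injections_total (pairing_field G) (~` pairing_field G).
  have [G' lt G'p] := partial_pairing_extend Gp Sc c_inj jS j_inj.
  exfalso; apply: (Gmax G' lt); right; split=> //.
  by case: lt => lt _; apply: subset_trans lt.
have [g [gS g_inj]] := partial_pairing_fun Gp.
set S := pairing_field G in Sc jS j_inj gS g_inj.
pose e x := if `[< S x >] then g (c true, x) else g (c false, j x).
have eS x : S (e x).
  by rewrite /e; case: asboolP => Sx; apply: gS (Sc _) _; [|apply: jS].
have e_inj : injective e.
  move=> x y; rewrite /e; case: asboolP => Sx; case: asboolP => Sy.
  - by move=> /g_inj[].
  - by move=> /g_inj[] //; [apply: jS|move=> /c_inj].
  - by move=> /g_inj[] //; [apply: jS|move=> /c_inj].
  - by move=> /g_inj[] //; [apply: jS..|move=> _ /j_inj; apply].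
exists (fun p => g (e p.1, e p.2)) => -[x y] [x' y'] /=.
by move=> /g_inj[] // /e_inj -> /e_inj ->.
Qed.

(** The iterated pairing of the entries determines a sequence of known length,
   so the length is coded as well. *)
Lemma infinite_seq_injection (T : Type) : infinite_set [set: T] ->
  exists h : seq T -> T, injective h.
Proof.
move=> Tinf; have [g g_inj] := infinite_pairing Tinf.
have [i i_inj] := infinite_nat_injection Tinf.
pose enc := foldr (fun x y => g (x, y)) (i 0).
have enc_inj s t : size s = size t -> enc s = enc t -> s = t.
  by elim: s t => [|x s IH] [|y t] //= [/IH st] /g_inj[-> /st ->].
exists (fun s => g (i (size s), enc s)) => s t.
by move=> /g_inj[/i_inj] /enc_inj.
Qed.

(** * Initial segments *)

Lemma prefix_inf_catl (X : eqType) (u v : seq X) (f : infseq X) :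
  prefix_inf (u ++ v) f -> prefix_inf u f.
Proof.
rewrite /prefix_inf size_cat => /(congr1 (take (size u))).
by rewrite take_size_cat // /mkseq -map_take take_iota (minn_idPl (leq_addr _ _)).
Qed.

Lemma prefix_inf_prefix (X : eqType) (u v : seq X) (f : infseq X) :
  prefix_inf u f -> prefix_inf v f -> size u <= size v -> prefix u v.
Proof.
move=> uf vf le_uv; rewrite prefixE -{2}uf -{1}vf.
by rewrite /mkseq -map_take take_iota (minn_idPl le_uv).
Qed.

Lemma prefix_inf_total (X : eqType) (u v : seq X) (f : infseq X) :
  prefix_inf u f -> prefix_inf v f -> prefix u v \/ prefix v u.
Proof.
move=> uf vf; have [le|/ltnW le] := leqP (size u) (size v).
  by left; apply: prefix_inf_prefix uf vf le.
by right; apply: prefix_inf_prefix vf uf le.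
Qed.

(** A point of the closure of [D] shares each of its segments with some point
   of [D]. *)
Lemma closed_segments (X : eqType) (D : set (infseq X)) :
  (forall f, (forall n, segments D (mkseq f n)) -> D f) -> closed D.
Proof.
move=> Dseg f clf; apply: Dseg => n.
have [|g [Dg fg]] := clf (cylinder (mkseq f n)); last by exists g.
apply: open_nbhs_nbhs; split; last by rewrite /cylinder /= /prefix_inf size_mkseq.
exists [set mkseq f n] => //.
by rewrite bigcup_set1.
Qed.

Lemma exists_minimal_prefix (X : eqType) (P : set (seq X)) w : P w ->
  exists v, [/\ prefix v w, P v & forall v', P v' -> prefix v' v -> v' = v].
Proof.
have [n] := ubnP (size w); elim: n w => // n IH w /ltnSE le Pw.
have [[v [Pv vw ne]]|none] :=
    EM (exists v, [/\ P v, prefix v w & v <> w]); last first.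
  exists w; split=> // [|v Pv vw]; first exact: prefix_refl.
  by apply: contrapT => ne; apply: none; exists v.
have lt_vw : size v < size w.
  rewrite ltn_neqAle size_prefix // andbT; apply/eqP => e.
  by apply: ne; move: vw; rewrite prefixE e take_size => /eqP.
have [|v' [vv' Pv' min]] := IH v _ Pv; first exact: leq_trans lt_vw le.
by exists v'; split=> //; apply: prefix_trans vw.
Qed.

(** * Trees and plays *)

(** This covers both the tree of words built from a strategy of I and the
   positions reached by legal moves along a given point. *)
Definition tree_of (T : Type) (child : seq T -> T -> Prop) : set (seq T) :=
  [set p | forall q x r, p = rcons q x ++ r -> child q x].

Lemma tree_of_nil (T : Type) (child : seq T -> T -> Prop) :
  tree_of child [::].
Proof. by move=> [|? ?]. Qed.

Lemma tree_of_rcons (T : Type) (child : seq T -> T -> Prop) p x :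
  tree_of child (rcons p x) <-> tree_of child p /\ child p x.
Proof.
split=> [px|[pP cx]].
  split=> [q y r e|]; last by apply: (px p x [::]); rewrite cats0.
  by apply: (px q y (rcons r x)); rewrite e rcons_cat.
move=> q y r; case/lastP: r => [|r z].
  by rewrite cats0 => /rcons_inj[<- <-].
by rewrite -rcons_cat => /rcons_inj[e _]; apply: pP e.
Qed.

Lemma tree_of_is_tree (X : eqType) (child : seq (seq X) -> seq X -> Prop) :
  is_tree (tree_of child).
Proof.
move=> p q /prefixP[r ->] J q' x r' e.
by apply: (J q' x (r' ++ r)); rewrite catA -e.
Qed.

Lemma dependent_choice_seq (T : Type) (P : seq T -> Prop) :
  P [::] -> (forall p, P p -> exists x, P (rcons p x)) ->
  exists a : nat -> T, forall n, P (mkseq a n).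
Proof.
move=> P0 ext; have [x0 _] := ext _ P0.
have /choice[g gP] : forall p, exists x, P p -> P (rcons p x).
  by move=> p; have [/ext[x Px]|nP] := EM (P p); [exists x|exists x0].
pose s n := iter n (fun p => rcons p (g p)) [::].
exists (g \o s) => n.
have -> : mkseq (g \o s) n = s n by elim: n => // n IH; rewrite mkseqS IH.
by elim: n => // n; apply: gP.
Qed.

(** The moves that a strategy [g] makes against the moves [s] of the opponent.
   A strategy of II answers the last move [x], given the earlier moves of both
   players; one of I moves before [x] and does not depend on it. The
   accumulator carries the moves of the opponent because [g] sees them all. *)
Definition follow (S T : Type) (g : seq S -> S -> seq T -> T) (s : seq S) :
    seq T :=
  (foldl (fun st x => (rcons st.1 x, rcons st.2 (g st.1 x st.2)))
     ([::], [::]) s).2.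

Lemma follow_rcons (S T : Type) (g : seq S -> S -> seq T -> T) s x :
  follow g (rcons s x) = rcons (follow g s) (g s x (follow g s)).
Proof.
rewrite /follow foldl_rcons /=; set st := foldl _ _ _.
suff -> : st.1 = s by [].
by rewrite /st; elim/last_ind: s {st} => // s y IH; rewrite foldl_rcons /= IH.
Qed.

Lemma follow_mkseq (S T : Type) (g : seq S -> S -> seq T -> T) (a : nat -> S) n :
  follow g (mkseq a n) =
  mkseq (fun i => g (mkseq a i) (a i) (follow g (mkseq a i))) n.
Proof. by elim: n => // n IH; rewrite !mkseqS follow_rcons -IH. Qed.

(** * Bodies of trees with incompatible successors *)

(** When successors in [J] are incompatible, a given length admits at most
   one node whose concatenation is a segment of [f], so the nodes that
   witness that [f] is in the body line up along one infinite branch. *)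
Lemma body_branch (X : eqType) (J : set (seq (seq X))) (f : infseq X) :
  is_tree J ->
  (forall p u v, J p -> J (rcons p u) -> J (rcons p v) -> prefix u v -> u = v) ->
  body J f ->
  exists2 v : nat -> seq X, infcat v f & forall n, J (mkseq v n).
Proof.
move=> treeJ anti bodyf.
have uniq s t : J s -> J t -> prefix_inf (flatten s) f ->
    prefix_inf (flatten t) f -> size s <= size t -> prefix s t.
  move=> + Jt + ft; elim/last_ind: s => [|s x IH] Jsx fsx; first by rewrite prefix0s.
  rewrite size_rcons => lt_st.
  have Js : J s by apply: treeJ Jsx; apply: prefix_rcons.
  rewrite -cats1 flatten_cat /= cats0 in fsx.
  have /prefixP[[|y t'] et] := IH Js (prefix_inf_catl fsx) (ltnW lt_st).
    by move: lt_st; rewrite et cats0 ltnn.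
  have Jsy : J (rcons s y).
    by apply: treeJ Jt; rewrite et -cat_rcons; apply: prefix_prefix.
  have fsy : prefix_inf (flatten s ++ y) f.
    apply: (@prefix_inf_catl _ _ (flatten t')); rewrite -catA.
    by move: ft; rewrite et flatten_cat.
  have [] := prefix_inf_total fsx fsy; rewrite prefix_catr // eqxx /= => xy.
    by rewrite (anti _ _ _ Js Jsx Jsy xy) et -cat_rcons prefix_prefix.
  by rewrite -(anti _ _ _ Js Jsy Jsx xy) et -cat_rcons prefix_prefix.
have /choice[s sP] := bodyf.
pose v n := nth [::] (s n) n.
have vs n : mkseq v n.+1 = s n.
  have [sz Js fs] := sP n.
  apply: (@eq_from_nth _ [::]); rewrite size_mkseq ?sz // => i lt_in.
  rewrite nth_mkseq // /v; have [sz' Js' fs'] := sP i.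
  have /prefixP[r ->] : prefix (s i) (s n) by apply: uniq => //; rewrite sz sz'.
  by rewrite nth_cat sz' ltnSn.
exists v.
  by case=> [|n]; [|rewrite vs; case: (sP n)].
case=> [|n]; last by rewrite vs; case: (sP n).
by have [_ J0 _] := sP 0; apply: treeJ J0; rewrite prefix0s.
Qed.

(** * Perfect subsets from strategies of Player I *)

(** The perfect tree consists of the minimal answers of I: minimality makes
   successors incompatible, and every condition that II may play is still
   forced by an extension of a successor, namely by the answer to it. *)
Lemma winning_I_perfect (X : eqType) (B : Type) (E : B -> set (seq X))
    (L : Type) (C : set (infseq X * (nat -> L))) :
  [set: B] !=set0 -> I_has_winning_strategy E C ->
  exists P : set (infseq X),
    [/\ P !=set0, perfect_for E P & P `<=` p_proj C].
Proof.
move=> [b0 _] [sigma sigmaP].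
pose hist := follow (fun bs (b : B) ms => sigma ms bs).
pose move_at bs := sigma (hist bs) bs.
pose word bs := sval (move_at bs).2.
have run_wins b : wins_I E C (fun i => move_at (mkseq b i)) b.
  by apply: sigmaP => n; rewrite /move_at /hist follow_mkseq.
have word_forces bs b : E b (word (rcons bs b)).
  have [_ /(_ (size bs))] := run_wins (nth b0 (rcons bs b)).
  have -> : mkseq (nth b0 (rcons bs b)) (size bs).+1 = rcons bs b.
    by rewrite -(size_rcons bs b) mkseq_nth.
  by rewrite nth_rcons ltnn eqxx.
have word_run b f : infcat (fun i => word (mkseq b i)) f -> p_proj C f.
  move=> fb; have [[g gb Cg] _] := run_wins b.
  have [h [_ huniq]] :=
    infcat_exists_unique (fun n => svalP (move_at (mkseq b n)).2).
  by rewrite -(huniq f fb) (huniq g gb); eexists; exact: Cg.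
pose minimal bs v := (exists b, word (rcons bs b) = v) /\
  forall b, prefix (word (rcons bs b)) v -> word (rcons bs b) = v.
have /choice[cond condP] :
    forall bsv, exists b, minimal bsv.1 bsv.2 -> word (rcons bsv.1 b) = bsv.2.
  move=> [bs v]; have [[[b bv] _]|nmin] := EM (minimal bs v); first by exists b.
  by exists b0.
(* The moves of II chosen so that I answers them with the given words. *)
pose conds := foldl (fun bs v => rcons bs (cond (bs, v))) [::].
(* The first word of I precedes all moves of II, so the root has one child. *)
pose child p v := if p is _ :: q then minimal (conds q) v else v = word [::].
pose J := tree_of child.
have treeJ : is_tree J by apply: tree_of_is_tree.
have anti p u v : J p -> J (rcons p u) -> J (rcons p v) -> prefix u v -> u = v.
  move=> _ /tree_of_rcons[_ +] /tree_of_rcons[_ +].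
  case: p => [|w q] /= => [-> -> //|[[b <-] _] [_ +] uv].
  exact.
have child_cons w q b :
    exists2 v, child (w :: q) v & prefix v (word (rcons (conds q) b)).
  have [|v [vw [b' b'v] min]] :=
    @exists_minimal_prefix _ [set v | exists b, word (rcons (conds q) b) = v]
      (word (rcons (conds q) b)); first by exists b.
  exists v => //; split; first by exists b'.
  by move=> b'' pv; apply: min pv; exists b''.
have childN0 p v : child p v -> v != [::].
  by case: p => [|w q] /= => [->|[[b <-] _]]; apply: (svalP (move_at _).2).
exists (body J); split.
- have [||v vJ] := @dependent_choice_seq _ J.
  + exact: tree_of_nil.
  + case=> [|w q] Jp; first by exists (word [::]); apply/tree_of_rcons; split.
    have [v cv _] := child_cons w q b0.
    by exists v; apply/tree_of_rcons; split.
  have vN0 n : v n != [::].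
    by have := vJ n.+1; rewrite mkseqS => /tree_of_rcons[_ /childN0].
  have [f [fv _]] := infcat_exists_unique vN0.
  by exists f => n; exists (mkseq v n.+1); rewrite size_mkseq.
- exists J => //; split=> // [p b Jp|p u v Jp Ju Jv ne].
    case: p Jp => // w q Jp _; have [v cv pv] := child_cons w q b.
    exists v, (word (rcons (conds q) b)); split=> //; first exact: childN0 cv.
    by apply/tree_of_rcons; split.
  split; apply/negP => pr; first exact/ne/(anti p).
  exact/ne/esym/(anti p).
- move=> f bodyf; have [v fv vJ] := body_branch treeJ anti bodyf.
  have vchild n : child (mkseq v n) (v n).
    by have := vJ n.+1; rewrite mkseqS => /tree_of_rcons[].
  pose q n := mkseq (fun i => v i.+1) n.
  have vS n : mkseq v n.+1 = v 0 :: q n.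
    by rewrite /q /mkseq /= (iotaDl 1 0 n) -map_comp.
  pose b n := cond (conds (q n), v n.+1).
  have condsq n : conds (q n) = mkseq b n.
    elim: n => // n IH; rewrite mkseqS -IH /q mkseqS /conds foldl_rcons.
    by rewrite -/(q n) -/conds.
  apply: (word_run b).
  have wv n : word (mkseq b n) = v n.
    case: n => [|n]; first by have := vchild 0.
    rewrite mkseqS -condsq; apply: (condP (conds (q n), v n.+1)) => /=.
    by have := vchild n.+1; rewrite vS.
  by move=> n; rewrite (eq_mkseq wv).
Qed.

(** * Meagerness from strategies of Player II *)

Definition play (X : eqType) (L : Type) (xi : L) (u : seq X) (uN0 : u != [::]) :
    moveI X L :=
  (xi, exist (fun u : seq X => is_true (u != [::])) u uN0).

Definition words (X : eqType) (L : Type) (p : seq (moveI X L)) : seq X :=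
  flatten [seq sval m.2 | m <- p].

Lemma words_rcons (X : eqType) (L : Type) (p : seq (moveI X L)) m :
  words (rcons p m) = words p ++ sval m.2.
Proof. by rewrite /words map_rcons flatten_rcons. Qed.

Section PlayerII.
Variables (X : eqType) (B : Type) (E : B -> set (seq X)) (L : Type).
Variable tau : seq (moveI X L) -> seq B -> B.

Definition replies := follow (fun p m bs => tau (rcons p m) bs).

Definition reply q m : B := tau (rcons q m) (replies q).

(** Player I is stuck along such a point even after lengthening the last word
   of the position: no further word along it forces the reply of II. Letting the last word grow is what makes
   this set nowhere dense, for then the reply to the lengthened position
   excludes all further extensions at once. *)
Definition stuck q m : set (infseq X) :=
  [set f | prefix_inf (words (rcons q m)) f /\
     forall m' v, m'.1 = m.1 -> prefix (sval m.2) (sval m'.2) -> v != [::] ->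
       prefix_inf (words (rcons q m') ++ v) f -> ~ E (reply q m') v].

(** Let [s] be the concatenation of the words of the position. Beyond [s], the
   reply to the lengthened position is never forced; before [s] is completed,
   all members continue with the same letter, which some condition
   excludes. *)
Lemma stuck_nowhere_dense q m :
  (forall x : X, exists b, forall u : seq X, u != [::] -> E b u ->
     nth x u 0 <> x) ->
  nowhere_dense_for E (stuck q m).
Proof.
move=> avoid; split.
  apply: closed_segments => f fD.
  have transfer u : prefix_inf u f ->
      exists2 g, stuck q m g & prefix_inf u g.
    by move=> uf; have [g Dg ug] := fD (size u); exists g; rewrite // -uf.
  split=> [|m' v e1 e2 vN0 /transfer[g [_ Dg] ug]]; last exact: Dg ug.
  have [g [sg _] fg] := fD (size (words (rcons q m))).
  by move: fg; rewrite /prefix_inf size_mkseq => <-.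
move=> u [f [sf _] uf].
have [le|lt] := leqP (size (words (rcons q m))) (size u).
  have /prefixP[u' eu] := prefix_inf_prefix sf uf le.
  have m'N0 : sval m.2 ++ u' != [::].
    by case: (sval m.2) (svalP m.2).
  pose m' := play m.1 m'N0.
  have eu' : words (rcons q m') = u by rewrite words_rcons eu words_rcons catA.
  exists (reply q m') => v vN0 [g [_ gD] ug].
  by apply: gD => //=; [apply: prefix_prefix|rewrite eu'].
have /prefixP[[|x s'] es] := prefix_inf_prefix uf sf (ltnW lt).
  by rewrite es cats0 ltnn in lt.
have [b bP] := avoid x; exists b => v vN0 [g [sg _] ug] /(bP _ vN0); apply.
have sz : size u < size (u ++ v).
  by rewrite size_cat -{1}[size u]addn0 ltn_add2l lt0n size_eq0.
have <- : nth x (u ++ v) (size u) = nth x v 0 by rewrite nth_cat ltnn subnn.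
rewrite -ug nth_mkseq //.
have := congr1 (fun s => nth x s (size u)) sg.
by rewrite nth_mkseq // es nth_cat ltnn subnn.
Qed.

(** If [f] with witness [xi] is never stuck, I can keep playing along [f]:
   at each position reached, lengthen the last word so that a further word
   along [f] forces the reply of II. The play built this way follows the
   strategy of II and is won by I. *)
Lemma winning_II_stuck (C : set (infseq X * (nat -> L))) :
  (forall (u v : seq X) b, u != [::] -> v != [::] ->
     prefix u v -> E b u -> E b v) ->
  (forall a b, (forall n, b n = tau (mkseq a n.+1) (mkseq b n)) ->
     ~ wins_I E C a b) ->
  forall f, p_proj C f -> exists q m, stuck q m f.
Proof.
move=> mono tau_wins f [xi Cf]; apply: contrapT => never.
pose child q m := [/\ prefix_inf (words (rcons q m)) f, m.1 = xi (size q) &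
  forall q0 m0, q = rcons q0 m0 -> E (reply q0 m0) (sval m.2)].
pose P q := tree_of child q /\ exists m, child q m.
have [||a aP] := @dependent_choice_seq _ P.
- split; first exact: tree_of_nil.
  have N0 : mkseq f 1 != [::] by [].
  exists (play (xi 0) N0); by split=> //; case.
- move=> q [Jq [m [mf mxi mE]]].
  have [m' [v [e1 e2 vN0 vf vE]]] : exists m' v, [/\ m'.1 = m.1,
      prefix (sval m.2) (sval m'.2), v != [::],
      prefix_inf (words (rcons q m') ++ v) f & E (reply q m') v].
    apply: contrapT => none; apply: never; exists q, m; split=> // m' v *.
    by move=> vE; apply: none; exists m', v.
  exists m'; split.
    apply/tree_of_rcons; split=> //; split; first exact: prefix_inf_catl vf.
      by rewrite e1.
    move=> q0 m0 /mE; apply: mono e2; [exact: (svalP m.2)|exact: (svalP m'.2)].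
  exists (play (xi (size q).+1) vN0); split.
  + by rewrite words_rcons.
  + by rewrite size_rcons.
  + by move=> q0 m0 /rcons_inj[<- <-].
have achild n : child (mkseq a n) (a n).
  by have [+ _] := aP n.+1; rewrite mkseqS => /tree_of_rcons[].
pose b n := reply (mkseq a n) (a n).
apply: (tau_wins a b) => [n|].
  by rewrite {1}/b /reply -mkseqS /replies follow_mkseq.
split=> [|n]; last by have [_ _] := achild n.+1; apply; rewrite mkseqS.
exists f; last first.
  rewrite (_ : (fun i => (a i).1) = xi) //; apply/funext => n.
  by have [_ -> _] := achild n; rewrite size_mkseq.
move=> n; have [+ _ _] := achild n.
by rewrite words_rcons /words /mkseq -map_comp; apply: prefix_inf_catl.
Qed.

End PlayerII.

(** A move is coded by the sequence of labels formed by its label and the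
   images of the letters of its word under an injection of [X] into [L]. *)
Lemma positions_injection (X : eqType) (L : Type) :
  countable [set: X] -> infinite_set [set: L] ->
  exists h : seq (moveI X L) * moveI X L -> L, injective h.
Proof.
move=> /countable_injP[k k_inj] Linf.
have [i i_inj] := infinite_nat_injection Linf.
have [h h_inj] := infinite_seq_injection Linf.
pose code (m : moveI X L) := h (m.1 :: [seq i (k x) | x <- sval m.2]).
have code_inj : injective code.
  move=> [xi [u uN0]] [xi' [u' u'N0]] /h_inj[-> /inj_map e].
  suff euu' : u = u' by subst; congr (_, exist _ _ _); exact: bool_irrelevance.
  by apply: e => x y /i_inj e; apply: k_inj e; apply: in_setT.
exists (fun p => h (code p.2 :: map code p.1)) => -[q m] [q' m'] /=.
by move=> /h_inj[/code_inj -> /(inj_map code_inj) ->].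
Qed.

Lemma winning_II_meager (X : eqType) (B : Type) (E : B -> set (seq X))
    (L : Type) (C : set (infseq X * (nat -> L))) :
  countable [set: X] -> condition_set E -> infinite_set [set: L] ->
  II_has_winning_strategy E C -> meager_for E L (p_proj C).
Proof.
move=> Xcount [_ mono avoid _] Linf [tau tauP].
have [h h_inj] := positions_injection Xcount Linf.
exists (fun i => \bigcup_(p in [set p | h p = i]) stuck E tau p.1 p.2); split.
  move=> i; have [[p pi]|none] := EM (exists p, h p = i).
    have -> : [set p | h p = i] = [set p].
      by apply/seteqP; split=> [p' /= |p' ->//]; rewrite -pi => /h_inj.
    by rewrite bigcup_set1; apply: stuck_nowhere_dense.
  have -> : [set p | h p = i] = set0.
    by rewrite -subset0 => p hp; apply: none; exists p.
  by rewrite bigcup_set0; split=> [|u [f []]]; first exact: closed0.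
move=> f /(winning_II_stuck mono tauP)[q [m fqm]].
by exists (h (q, m)) => //; exists (q, m).
Qed.

Theorem theorem5p4p4 (X : eqType) (B : Type) (E : B -> set (seq X))
    (L : Type) (R : rel L) (A : set (infseq X)) (C : set (infseq X * (nat -> L)))
    (X_countable : countable [set: X])
    (X_two : exists x y : X, x <> y)
    (E_cond : condition_set E)
    (B_countable : countable [set: B])
    (R_ordinal : well_order R)
    (L_infinite : infinite_set [set: L])
    (A_proj : A = p_proj C) :
  (I_has_winning_strategy E C ->
     exists P : set (infseq X), [/\ P !=set0, perfect_for E P & P `<=` A]) /\
  (II_has_winning_strategy E C -> meager_for E L A).
Proof.
subst A; split; last exact: winning_II_meager.
by apply: winning_I_perfect; have [[]] := E_cond.
Qed.
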